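(* Let $A$ be a non-negative, irreducible $d\times d$ matrix with $\rho(A)>1$, and let $M=(I-A^T)(I-A)$ and $N=(I-A)(I-A^T)$. Suppose an entrywise strictly positive matrix $X$ is a local minimum of problem (P). Then the following hold. - $X$ is a global minimum of (P). - Let $\mathbf v$ be the right leading eigenvector of $X$ with $\|\mathbf v\|=1$. Then $\mathbf v$ is an eigenvector of $M$ associated with its smallest eigenvalue $\mu$, and $\mu>0$. - The vector $\mathbf u=\frac1{\sqrt\mu}(A-I)\mathbf v$ is a non-negative left leading eigenvector of $X$ and an eigenvector of $N$ associated with its smallest eigenvalue. - $X=A-(A-I)\mathbf v\mathbf v^T$ and $\|X-A\|=\sqrt\mu$. In particular, if $M$ has no non-negative unit eigenvector $\mathbf v$ for its smallest eigenvalue $\mu$ such that $(A-I)\mathbf v\ge0$ and $A-(A-I)\mathbf v\mathbf v^T\ge0$, then (P) has no strictly positive local minimum.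
   Context: $\rho(\cdot)$ denotes spectral radius and $\|\cdot\|$ the Frobenius norm (Euclidean norm for vectors). Problem (P) for a non-negative square matrix $A$ is: minimize $\|X-A\|$ subject to $X\ge0$ (entrywise) and $\rho(X)\le1$. A local minimum of (P) is a feasible $X$ with a neighbourhood $U$ such that $\|Y-A\|\ge\|X-A\|$ for all feasible $Y\in U$. Leading eigenvectors are the non-negative eigenvectors for the eigenvalue $\rho(X)$ given by Perron–Frobenius. *)

(* Defs.v *)
From HB Require Import structures.
From mathcomp Require Import all_boot all_order all_algebra.
From Stdlib Require Import ClassicalEpsilon.
Set Implicit Arguments. Unset Strict Implicit. Unset Printing Implicit Defensive.
Import Order.TTheory GRing.Theory Num.Theory.
Local Open Scope ring_scope.

(* Complex eigenvalue a + i b of a real matrix X: there is a nonzero complex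
   vector x + i y with X (x + i y) = (a + i b)(x + i y), written in real parts. *)
Definition ceigenvalue {R : rcfType} {d : nat} (X : 'M[R]_d) (a b : R) : Prop :=
  exists x y : 'cV[R]_d, (x != 0 \/ y != 0) /\
    X *m x = a *: x - b *: y /\ X *m y = b *: x + a *: y.

Definition cmod {R : rcfType} (a b : R) : R := Num.sqrt (a ^+ 2 + b ^+ 2).

Definition is_spectral_radius {R : rcfType} {d : nat} (X : 'M[R]_d) (r : R) : Prop :=
  (exists a b, ceigenvalue X a b /\ r = cmod a b) /\
  (forall a b, ceigenvalue X a b -> cmod a b <= r).

(* spectral radius rho(X) (0 when the spectrum is empty, i.e. d = 0) *)
Definition spectral_radius {R : rcfType} {d : nat} (X : 'M[R]_d) : R :=
  epsilon (inhabits 0) (fun r => is_spectral_radius X r).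

Definition frob {R : rcfType} {m n : nat} (X : 'M[R]_(m, n)) : R :=
  Num.sqrt (\sum_i \sum_j X i j ^+ 2).
Definition vnorm {R : rcfType} {d : nat} (v : 'cV[R]_d) : R :=
  Num.sqrt (\sum_i v i 0 ^+ 2).

Definition nonneg_mx {R : rcfType} {m n : nat} (X : 'M[R]_(m, n)) : Prop :=
  forall i j, 0 <= X i j.
Definition pos_mx {R : rcfType} {m n : nat} (X : 'M[R]_(m, n)) : Prop :=
  forall i j, 0 < X i j.

(* A is irreducible: not permutation-similar to a block upper triangular
   matrix, i.e. there is no nonempty proper index set S with A i j = 0
   for all i in S, j not in S. *)
Definition irreducible_mx {R : rcfType} {d : nat} (A : 'M[R]_d) : Prop :=
  ~ exists S : {set 'I_d}, S != set0 /\ S != setT /\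
      (forall i j, i \in S -> j \notin S -> A i j = 0).

Definition feasible {R : rcfType} {d : nat} (X : 'M[R]_d) : Prop :=
  nonneg_mx X /\ spectral_radius X <= 1.

Definition local_min_P {R : rcfType} {d : nat} (A X : 'M[R]_d) : Prop :=
  feasible X /\ exists eps : R, 0 < eps /\
    forall Y, feasible Y -> frob (Y - X) < eps -> frob (X - A) <= frob (Y - A).

Definition global_min_P {R : rcfType} {d : nat} (A X : 'M[R]_d) : Prop :=
  feasible X /\ forall Y, feasible Y -> frob (X - A) <= frob (Y - A).

Definition right_leading {R : rcfType} {d : nat} (X : 'M[R]_d) (v : 'cV[R]_d) : Prop :=
  nonneg_mx v /\ v != 0 /\ X *m v = spectral_radius X *: v.
Definition left_leading {R : rcfType} {d : nat} (X : 'M[R]_d) (u : 'cV[R]_d) : Prop :=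
  nonneg_mx u /\ u != 0 /\ u^T *m X = spectral_radius X *: u^T.

Definition smallest_eigenvalue {R : rcfType} {d : nat} (M : 'M[R]_d) (mu : R) : Prop :=
  eigenvalue M mu /\ forall l, eigenvalue M l -> mu <= l.

(* Main.v *)
(* Write B = A - 1. For w != 0 the matrix closest to A among those fixing w is
   A - B w w^T / |w|^2, at distance |B w| / |w| from A.

   A positive local minimum X has a positive fixed vector v: otherwise X z < z
   for some z > 0, and X could be moved towards A. Moving X towards the matrix
   closest to A that fixes v keeps v fixed, so X is that matrix. Replacing v
   by a nearby vector w gives a positive matrix fixing w > 0, which is feasible
   and near X. So v is a local, hence global, minimum of |B w|^2 / |w|^2.

   If Y is feasible, the segment from Y to A contains a matrix with eigenvalue 1
   since rho(Y) <= 1 < rho(A), and a matrix fixing w is at distance at least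
   |B w| / |w| from A. This makes X a global minimum.

   Over a real closed field there are no limits of powers or compactness
   arguments, so the Perron-Frobenius facts come from the intermediate value
   theorem for polynomials, applied to the cofactors of a pencil. *)
Require Import Defs.
From HB Require Import structures.
From mathcomp Require Import all_boot all_order all_algebra.
From mathcomp Require Import complex polyrcf.
From mathcomp Require Import ring lra.
From Stdlib Require Import ClassicalEpsilon.
Import Order.TTheory GRing.Theory Num.Theory.
Set Implicit Arguments. Unset Strict Implicit. Unset Printing Implicit Defensive.
Local Open Scope ring_scope.

Lemma mxBE (R : zmodType) m n (X Y : 'M[R]_(m, n)) i j :
  (X - Y) i j = X i j - Y i j.
Proof. by rewrite !mxE. Qed.

(** * Neighbourhoods of 0 and continuity at 0 *)

Section NearZero.
Variable R : rcfType.
Implicit Types (P Q : R -> Prop) (f g : R -> R).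

(** The parameter takes both signs; this is what later forces first-order terms to vanish. *)
Definition near0 P := exists2 e : R, 0 < e & forall t, `|t| < e -> P t.
Definition cont0 f := forall e : R, 0 < e -> near0 (fun t => `|f t - f 0| < e).

Lemma near0_imp P Q : (forall t, P t -> Q t) -> near0 P -> near0 Q.
Proof. by move=> PQ [e e0 Pe]; exists e => // t /Pe/PQ. Qed.

Lemma near0_and P Q : near0 P -> near0 Q -> near0 (fun t => P t /\ Q t).
Proof.
move=> [e e0 Pe] [f f0 Qf]; exists (Num.min e f); first by rewrite lt_min e0.
by move=> t; rewrite lt_min => /andP[/Pe ? /Qf ?].
Qed.

Lemma near0_all (I : finType) (P : I -> R -> Prop) :
  (forall i, near0 (P i)) -> near0 (fun t => forall i, P i t).
Proof.
move=> nP; suff [e e0 Pe] : near0 (fun t => forall i, i \in enum I -> P i t).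
  by exists e => // t /Pe Pt i; apply: Pt; rewrite mem_enum.
elim: (enum I) => [|i s]; first by exists 1.
move=> /(near0_and (nP i)); apply: near0_imp => t [Pi Ps] j.
by rewrite in_cons => /predU1P[->|/Ps].
Qed.

Lemma near0_pos_witness P : near0 P -> exists2 t, 0 < t < 1 & P t.
Proof.
move=> [e e0 Pe]; exists (Num.min e 1 / 2).
  have m0 : 0 < Num.min e 1 by rewrite lt_min e0 ltr01.
  have : Num.min e 1 <= 1 by rewrite ge_min lexx orbT.
  by move: (Num.min e 1) m0 => m; lra.
have m0 : 0 < Num.min e 1 by rewrite lt_min e0 ltr01.
have me : Num.min e 1 <= e by rewrite ge_min lexx.
by apply: Pe; rewrite gtr0_norm; move: (Num.min e 1) m0 me => m; lra.
Qed.

Lemma cont0_gt0 f : cont0 f -> 0 < f 0 -> near0 (fun t => 0 < f t).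
Proof.
move=> cf f0; apply: near0_imp (cf _ f0) => t.
by rewrite ltr_norml => /andP[+ _]; lra.
Qed.

Lemma cont0_cst c : cont0 (fun=> c).
Proof. by move=> e e0; exists 1 => // t _; rewrite subrr normr0. Qed.

Lemma cont0_id : cont0 (fun t => t).
Proof. by move=> e e0; exists e => // t; rewrite subr0. Qed.

Lemma cont0D f g : cont0 f -> cont0 g -> cont0 (fun t => f t + g t).
Proof.
move=> cf cg e e0; have e2 : 0 < e / 2 by lra.
apply: near0_imp (near0_and (cf _ e2) (cg _ e2)) => t [].
by rewrite !ltr_norml => /andP[? ?] /andP[? ?]; apply/andP; split; lra.
Qed.

Lemma cont0M f g : cont0 f -> cont0 g -> cont0 (fun t => f t * g t).
Proof.
(* When both increments are below [h <= 1], the error is less than [h * C]; [h] is chosen so that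
   [2 * h * C <= e]. *)
move=> cf cg e e0; pose C := `|f 0| + `|g 0| + 1.
have C1 : 1 <= C by rewrite /C -[leLHS]add0r lerD2r addr_ge0.
pose h := Num.min 1 (e / (2 * C)).
have h0 : 0 < h by rewrite lt_min ltr01 divr_gt0 //; lra.
have h1 : h <= 1 by rewrite ge_min lexx.
have hC : h * (2 * C) <= e.
  by rewrite -ler_pdivlMr; [rewrite ge_min lexx orbT | lra].
apply: near0_imp (near0_and (cf _ h0) (cg _ h0)) => t [].
set a := f t - f 0; set b := g t - g 0 => ah bh.
have -> : f t * g t - f 0 * g 0 = a * b + a * g 0 + f 0 * b.
  by rewrite /a /b; ring.
apply: (@le_lt_trans _ _ (h * `|b| + h * `|g 0| + `|f 0| * h)).
  apply: (le_trans (ler_normD _ _)); apply: lerD.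
    apply: (le_trans (ler_normD _ _)); rewrite !normrM.
    by apply: lerD; apply: ler_wpM2r => //; apply: ltW.
  by rewrite normrM ler_wpM2l //; apply: ltW.
have hb : h * `|b| < h * 1 by rewrite ltr_pM2l // (lt_le_trans bh).
apply: (lt_le_trans _ hC).
have : 0 <= h * C by rewrite mulr_ge0 ?ltW //; lra.
have -> : h * (2 * C) = h * C + h * C by ring.
have : h * C = `|f 0| * h + h * `|g 0| + h by rewrite /C; ring.
lra.
Qed.

Lemma cont0N f : cont0 f -> cont0 (fun t => - f t).
Proof.
by move=> cf e e0; apply: near0_imp (cf e e0) => t; rewrite -opprD normrN.
Qed.

Lemma cont0B f g : cont0 f -> cont0 g -> cont0 (fun t => f t - g t).
Proof. by move=> cf cg; apply: cont0D => //; apply: cont0N. Qed.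

Lemma cont0V f : cont0 f -> 0 < f 0 -> cont0 (fun t => (f t)^-1).
Proof.
(* Near 0, [f t] exceeds [c], so the difference of inverses is at most [|f t - f 0| / (c * f 0)];
   hence the tolerance [e * c * f 0]. *)
move=> cf f0 e e0; pose c := f 0 / 2.
have c0 : 0 < c by rewrite divr_gt0.
have h0 : 0 < e * c * f 0 by apply: mulr_gt0 => //; apply: mulr_gt0.
apply: near0_imp (near0_and (cf _ c0) (cf _ h0)) => t [].
rewrite ltr_norml => /andP[+ _]; rewrite /c => fc fh.
have ft : c < f t by rewrite /c; lra.
have ft0 : 0 < f t by apply: lt_trans ft.
have -> : (f t)^-1 - (f 0)^-1 = - (f t - f 0) / (f t * f 0).
  by field; rewrite !gt_eqF.
rewrite normrM normrN normfV (gtr0_norm (mulr_gt0 ft0 f0)).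
rewrite ltr_pdivrMr ?mulr_gt0 //; apply: (lt_trans fh).
by rewrite [ltRHS]mulrA ltr_pM2r // ltr_pM2l.
Qed.

Lemma cont0_sum (I : Type) (r : seq I) (f : I -> R -> R) :
  (forall i, cont0 (f i)) -> cont0 (fun t => \sum_(i <- r) f i t).
Proof.
move=> cf; elim: r => [|i r IH] e e0.
  by exists 1 => // t _; rewrite !big_nil subrr normr0.
apply: near0_imp (cont0D (cf i) IH e0) => t.
by rewrite !big_cons.
Qed.

Lemma cont0_affine (a b : R) : cont0 (fun t => a + t * b).
Proof.
apply: cont0D; first exact: cont0_cst.
by apply: cont0M; [apply: cont0_id|apply: cont0_cst].
Qed.

Lemma affine_mxE m n (P Q : 'M[R]_(m, n)) t i j :
  (P + t *: Q) i j = P i j + t * Q i j.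
Proof. by rewrite !mxE. Qed.

Lemma cont0_affine_mx m n (P Q : 'M[R]_(m, n)) i j :
  cont0 (fun t => (P + t *: Q) i j).
Proof.
by move=> e e0; apply: near0_imp (cont0_affine (P i j) (Q i j) e0) => t;
  rewrite !affine_mxE.
Qed.

(** First- and second-order conditions at a minimum. Dividing by [|t|] gives [2 b + t c >= 0] and
    [- 2 b + t c >= 0] for small [t > 0]; the sum gives [c >= 0], and small [t] excludes
    [b != 0]. *)
Lemma quadratic_ge0_near0 (b c : R) :
  near0 (fun t => 0 <= 2 * t * b + t ^+ 2 * c) -> b = 0 /\ 0 <= c.
Proof.
move=> [e e0 h]; have h1 t : 0 < t < e -> 0 <= 2 * b + t * c.
  move=> /andP[t0 te]; rewrite -(pmulr_rge0 _ t0).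
  by have := h t; rewrite gtr0_norm // => /(_ te); lra.
have h2 t : 0 < t < e -> 0 <= - (2 * b) + t * c.
  move=> /andP[t0 te]; rewrite -(pmulr_rge0 _ t0).
  by have := h (- t); rewrite normrN gtr0_norm // => /(_ te); lra.
have e2 : 0 < e / 2 < e by apply/andP; split; lra.
have c0 : 0 <= c.
  by have := h1 _ e2; have := h2 _ e2; rewrite -(pmulr_rge0 c (_ : 0 < e / 2)); lra.
have small t : 0 < t < e -> 0 <= t * c by move=> /andP[/ltW ? _]; rewrite mulr_ge0.
split=> //; apply/eqP; rewrite eq_le; apply/andP; split; rewrite leNgt; apply/negP => b0.
(* This [t] gives [t * c < b], against [2 * b <= t * c]; the [+ 1] keeps the denominator positive
   when [c = 0]. *)
- pose t := Num.min (e / 2) (b / (c + 1)).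
  have c1 : 0 < c + 1 by lra.
  have t0 : 0 < t by rewrite lt_min divr_gt0 // divr_gt0.
  have te : t < e by rewrite gt_min; apply/orP; left; lra.
  have tb : t * (c + 1) <= b by rewrite -ler_pdivlMr // ge_min lexx orbT.
  by have := h2 t; rewrite t0 te => /(_ isT); lra.
- pose t := Num.min (e / 2) (- b / (c + 1)).
  have c1 : 0 < c + 1 by lra.
  have t0 : 0 < t by rewrite lt_min divr_gt0 // divr_gt0 // oppr_gt0.
  have te : t < e by rewrite gt_min; apply/orP; left; lra.
  have tb : t * (c + 1) <= - b by rewrite -ler_pdivlMr // ge_min lexx orbT.
  by have := h1 t; rewrite t0 te => /(_ isT); lra.
Qed.

End NearZero.

Lemma neq0_cV_ex (R : rcfType) d (v : 'cV[R]_d) : v != 0 -> exists i, v i 0 != 0.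
Proof.
move=> v0; apply/existsP; apply: contraNT v0 => /existsPn v0.
by apply/eqP/colP => i; rewrite mxE; apply/eqP; move: (v0 i); rewrite negbK.
Qed.

(** * Collatz-Wielandt comparison for nonnegative matrices *)

Section CollatzWielandt.
Variables (R : rcfType) (d : nat).
Implicit Types (X Y : 'M[R]_d) (v w x z m : 'cV[R]_d).

(* Compare [m] with the largest multiple of [z] touching it. *)
Lemma collatz_wielandt Y z m (c : R) :
  nonneg_mx Y -> pos_mx z -> nonneg_mx m -> m != 0 ->
  (forall i, c * m i 0 <= (Y *m m) i 0) ->
  exists i, c * z i 0 <= (Y *m z) i 0.
Proof.
move=> Y0 z0 m0 mN0 cm; have [i0 mi0] := neq0_cV_ex mN0.
pose F i := m i 0 / z i 0.
have [i _ Fi] := @arg_maxP _ _ _ i0 xpredT F isT.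
have le_m j : m j 0 <= F i * z j 0.
  by rewrite -ler_pdivrMr //; apply: Fi.
have Fi0 : 0 < F i.
  apply: lt_le_trans (Fi i0 isT); rewrite divr_gt0 //.
  by rewrite lt_neqAle eq_sym mi0 m0.
have mE : m i 0 = F i * z i 0 by rewrite /F divfK // gt_eqF.
exists i; rewrite -(ler_pM2l Fi0) mulrCA -mE (le_trans (cm i)) //.
rewrite !mxE mulr_sumr ler_sum // => j _.
by rewrite mulrCA ler_wpM2l.
Qed.

Lemma mulmx_nonneg p q r (X : 'M[R]_(p, q)) (Y : 'M[R]_(q, r)) :
  nonneg_mx X -> nonneg_mx Y -> nonneg_mx (X *m Y).
Proof.
by move=> X0 Y0 i j; rewrite mxE sumr_ge0 // => k _; rewrite mulr_ge0.
Qed.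

Lemma mulmx_pos X m : pos_mx X -> nonneg_mx m -> m != 0 -> pos_mx (X *m m).
Proof.
move=> X0 m0 mN0 i j; rewrite ord1 mxE; have [k mk] := neq0_cV_ex mN0.
rewrite (bigD1 k) //= ltr_pwDl //.
  by rewrite mulr_gt0 // lt_neqAle eq_sym mk m0.
by rewrite sumr_ge0 // => l _; rewrite mulr_ge0 // ltW.
Qed.

Lemma pos_nonneg p q (X : 'M[R]_(p, q)) : pos_mx X -> nonneg_mx X.
Proof. by move=> X0 i j; apply: ltW. Qed.

(** A minimum principle: the negative part [m] of [p] satisfies [m <= Y m], so if [m] were nonzero,
    [collatz_wielandt] would contradict [Y z < z]. *)
Lemma subinv_nonneg Y z (p : 'cV[R]_d) :
  nonneg_mx Y -> pos_mx z -> (forall i, (Y *m z) i 0 < z i 0) ->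
  (forall i, (Y *m p) i 0 <= p i 0) -> nonneg_mx p.
Proof.
move=> Y0 z0 zlt ple i j; rewrite ord1 leNgt; apply/negP => pi.
pose m : 'cV[R]_d := \col_i Num.max (- p i 0) 0.
have m0 : nonneg_mx m by move=> k l; rewrite mxE le_max lexx orbT.
have mN0 : m != 0.
  apply/eqP => /colP/(_ i); rewrite !mxE => mi.
  have : - p i 0 <= Num.max (- p i 0) 0 by rewrite le_max lexx.
  by rewrite mi; lra.
have [|k] := @collatz_wielandt Y z m 1 Y0 z0 m0 mN0.
  move=> k; rewrite mul1r mxE ge_max (mulmx_nonneg Y0 m0) andbT.
  rewrite lerNl (le_trans _ (ple k)) //.
  rewrite !mxE -sumrN ler_sum // => l _; rewrite -mulrN ler_wpM2l //.
  by rewrite lerNl mxE le_max lexx.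
by rewrite mul1r leNgt zlt.
Qed.

(** Cauchy-Schwarz in the plane, from Lagrange's identity. *)
Lemma dot2_le (a b x y : R) :
  a * x + b * y <= Num.sqrt (a ^+ 2 + b ^+ 2) * Num.sqrt (x ^+ 2 + y ^+ 2).
Proof.
rewrite -sqrtrM ?addr_ge0 ?sqr_ge0 //.
apply: (le_trans (ler_norm _)); rewrite -sqrtr_sqr ler_wsqrtr //.
have : 0 <= (a * y - b * x) ^+ 2 by apply: sqr_ge0.
by lra.
Qed.

(** The vector [m] of moduli of the entries of an eigenvector satisfies [cmod a b * m <= Y m] by the
    triangle inequality, so [collatz_wielandt] applies to it. *)
Lemma ceigenvalue_bound Y z (a b : R) :
  nonneg_mx Y -> pos_mx z -> ceigenvalue Y a b ->
  exists i, cmod a b * z i 0 <= (Y *m z) i 0.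
Proof.
move=> Y0 z0 [x [y [xy0 [Yx Yy]]]].
pose m : 'cV[R]_d := \col_i cmod (x i 0) (y i 0).
have m0 : nonneg_mx m by move=> i j; rewrite mxE sqrtr_ge0.
apply: (@collatz_wielandt Y z m) => //.
  apply: contraPN xy0 => /eqP/colP m0'.
  have xy i : x i 0 = 0 /\ y i 0 = 0.
    have /eqP := m0' i; rewrite !mxE sqrtr_eq0 => h.
    by have := sqr_ge0 (x i 0); have := sqr_ge0 (y i 0); split;
      apply/eqP; rewrite -sqrf_eq0; apply/eqP; lra.
  by case=> /eqP; apply; apply/colP => i; rewrite mxE; case: (xy i).
move=> i; set p := (Y *m x) i 0; set q := (Y *m y) i 0.
have cpq : cmod a b * m i 0 = cmod p q.
  rewrite /p /q Yx Yy !mxE /cmod -sqrtrM ?addr_ge0 ?sqr_ge0 //.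
  by congr Num.sqrt; ring.
rewrite cpq; have : 0 <= cmod p q by apply: sqrtr_ge0.
rewrite le_eqVlt => /predU1P[<-|pq0]; first exact: mulmx_nonneg.
(* The triangle inequality is obtained by expanding the dot product of [(p, q)] with itself along
   [j] and bounding each term by [dot2_le]. *)
rewrite -(ler_pM2l pq0).
have -> : cmod p q * cmod p q = p * p + q * q.
  by rewrite -expr2 sqr_sqrtr ?addr_ge0 ?sqr_ge0 // !expr2.
rewrite {2}/p {2}/q !mxE !mulr_sumr -big_split /= ler_sum // => j _.
rewrite mxE !(mulrCA _ (Y i j)) -mulrDr ler_wpM2l //; exact: dot2_le.
Qed.

End CollatzWielandt.

(** * Existence and bounds of the spectral radius *)

Section SpectralRadius.
Variables (R : rcfType) (d : nat).
Implicit Types (X Y : 'M[R]_d) (v w x z : 'cV[R]_d).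

(** The transpose appears because [eigenvalue] concerns row vectors, while [ceigenvalue] concerns
    columns. *)
Lemma ceigenvalue_complex X (l : R[i]) :
  eigenvalue (map_mx (real_complex R) X^T) l <-> ceigenvalue X (complex.Re l) (complex.Im l).
Proof.
have Re_sum (f : 'I_d -> R[i]) : complex.Re (\sum_j f j) = \sum_j complex.Re (f j).
  by apply: (big_morph (@complex.Re R)) => // -[? ?] [? ?].
have Im_sum (f : 'I_d -> R[i]) : complex.Im (\sum_j f j) = \sum_j complex.Im (f j).
  by apply: (big_morph (@complex.Im R)) => // -[? ?] [? ?].
split=> [/eigenvalueP[v vX v0]|[x [y [xy0 [Xx Xy]]]]].
  exists (\col_i complex.Re (v 0 i)), (\col_i complex.Im (v 0 i)); split.
    apply/orP; rewrite -negb_and; apply: contra v0 => /andP[/eqP/colP x0 /eqP/colP y0].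
    apply/eqP/rowP => i; move: (x0 i) (y0 i); rewrite !mxE.
    by case: (v 0 i) => a b /= -> ->.
  split; apply/colP => i; rewrite !mxE.
    have := congr1 (fun u : 'rV_d => complex.Re (u 0 i)) vX; rewrite !mxE Re_sum.
    case: (v 0 i) l {vX} => a b [c e] /= <-; apply: eq_bigr => j _.
    by rewrite !mxE; case: (v 0 j) => p q /=; ring.
  have := congr1 (fun u : 'rV_d => complex.Im (u 0 i)) vX; rewrite !mxE Im_sum.
  case: (v 0 i) l {vX} => a b [c e] /= h.
  transitivity (c * b + e * a); last by ring.
  rewrite -h; apply: eq_bigr => j _.
  by rewrite !mxE; case: (v 0 j) => p q /=; ring.
apply/eigenvalueP; exists (\row_i Complex (x i 0) (y i 0)).
  apply/rowP => i; rewrite !mxE.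
  have := congr1 (fun u : 'cV_d => u i 0) Xx.
  have := congr1 (fun u : 'cV_d => u i 0) Xy.
  rewrite !mxE; case: l {Xx Xy} => c e /= hy hx.
  apply/eqP; rewrite eq_complex Re_sum Im_sum /= [c * y i 0 + _]addrC -hx -hy.
  apply/andP; split; apply/eqP; apply: eq_bigr => j _; rewrite !mxE /=; ring.
apply: contraPneq xy0 => /rowP xy0.
have xy i : x i 0 = 0 /\ y i 0 = 0 by have := xy0 i; rewrite !mxE => -[-> ->].
by case=> /eqP; apply; apply/colP => i; rewrite mxE; case: (xy i).
Qed.

(** Over [R[i]] the characteristic polynomial splits, so the spectrum is a finite list, nonempty in
    positive dimension, and has an element of largest modulus. *)
Lemma spectral_radiusP X : (0 < d)%N -> is_spectral_radius X (spectral_radius X).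
Proof.
move=> d0; apply: epsilon_spec.
set Xc := map_mx (real_complex R) X^T.
have [s ps] := closed_field_poly_normal (char_poly Xc).
have sP l : eigenvalue Xc l = (l \in s).
  rewrite eigenvalue_root_char ps rootZ ?root_prod_XsubC //.
  by rewrite lead_coef_eq0 -size_poly_eq0 size_char_poly.
have [l0 l0s] : exists l, l \in s.
  by have [l] := Theorem7' Xc d0; rewrite sP; exists l.
have [l ls lmax] : exists2 l, l \in s &
    forall k, k \in s -> cmod (complex.Re k) (complex.Im k) <= cmod (complex.Re l) (complex.Im l).
  elim: s {ps sP} l0 l0s => // k s IH _ _.
  case: s IH => [|k' s] IH.
    by exists k; rewrite ?mem_head // => j; rewrite inE => /eqP->.
  have [l ls lmax] := IH k' (mem_head _ _).
  have [le|/ltW le] := leP (cmod (complex.Re l) (complex.Im l)) (cmod (complex.Re k) (complex.Im k)).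
    exists k; rewrite ?mem_head // => j; rewrite in_cons => /predU1P[->//|js].
    exact: le_trans (lmax _ js) le.
  exists l; first by rewrite in_cons ls orbT.
  by move=> j; rewrite in_cons => /predU1P[->//|]; apply: lmax.
exists (cmod (complex.Re l) (complex.Im l)); split.
  by exists (complex.Re l), (complex.Im l); split=> //; apply/ceigenvalue_complex; rewrite sP.
move=> a b ab; apply: (lmax (Complex a b)).
by rewrite -sP; apply/ceigenvalue_complex.
Qed.

Lemma eigenvector_le_spectral_radius X w (l : R) :
  X *m w = l *: w -> w != 0 -> l <= spectral_radius X.
Proof.
move=> Xw w0; have [i _] := neq0_cV_ex w0.
have d0 : (0 < d)%N by apply: leq_ltn_trans (ltn_ord i).
have [_ /(_ l 0)] := spectral_radiusP X d0.
rewrite /cmod expr0n addr0 sqrtr_sqr => h; apply: le_trans (ler_norm _) (h _).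
by exists w, 0; rewrite Xw mulmx0 !scaler0 scale0r subr0 addr0; split=> //; left.
Qed.

Lemma spectral_radius_le Y z (s : R) : (0 < d)%N ->
  nonneg_mx Y -> pos_mx z -> (forall i, (Y *m z) i 0 <= s * z i 0) ->
  spectral_radius Y <= s.
Proof.
move=> d0 Y0 z0 Yz; have [[a [b [ab ->]]] _] := spectral_radiusP Y d0.
have [i ci] := ceigenvalue_bound Y0 z0 ab.
by rewrite -(ler_pM2r (z0 i 0)) (le_trans ci).
Qed.

End SpectralRadius.

(** * First roots of polynomial families and transport of subinvariant vectors *)

Section Homotopy.
Variable R : rcfType.

(* Inspect the smallest root of the product of the [p i]. *)
Lemma poly_family_gt0 (I : finType) (p : I -> {poly R}) :
  (forall i, 0 < (p i).[0]) ->
  (forall t, 0 <= t <= 1 -> (forall i, 0 <= (p i).[t]) ->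
     forall i, 0 < (p i).[t]) ->
  forall i, 0 < (p i).[1].
Proof.
move=> p0 pge i; rewrite ltNge; apply/negP => pi1.
pose P := \prod_i p i.
have P0 : 0 < P.[0] by rewrite horner_prod prodr_gt0.
have rootP j t : root (p j) t -> root P t.
  by move=> /rootP pj; apply/rootP; rewrite horner_prod (bigD1 j) //= pj mul0r.
have first_root j y : 0 <= y -> (p j).[y] <= 0 ->
    exists2 x, 0 < x <= y & root (p j) x.
  move=> y0 pjy; have [|x] := polyrcf.poly_ivt (p := p j) y0.
    by rewrite mulr_ge0_le0 // ltW.
  rewrite in_itv /= => /andP[x0 xy] rx; exists x => //.
  rewrite xy andbT lt_neqAle x0 andbT; apply: contraTneq rx => <-.
  by rewrite /root gt_eqF.
have [x /andP[x0 x1] rx] := first_root i 1 ler01 pi1.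
(* The right end 2 puts the root [x <= 1] strictly inside the interval, which excludes the case
   without roots. *)
case: (next_rootP P 0 2) => [Pz|y _ Py|c _ _ /(_ x)].
- by move: P0; rewrite Pz horner0 ltxx.
- rewrite in_itv /= => /andP[y0 _] ynoroot.
  have yx : y <= x.
    rewrite leNgt; apply/negP => xy; have := ynoroot x.
    by rewrite in_itv /= x0 xy (rootP _ _ rx) => /(_ isT).
  (* A negative value at [y] would give [p j], hence [P], a root before [y]. *)
  have pjy j : 0 <= (p j).[y].
    rewrite leNgt; apply/negP => pjy.
    have [x' /andP[x'0 x'y] rx'] := first_root j y (ltW y0) (ltW pjy).
    move: x'y; rewrite le_eqVlt => /predU1P[x'y|x'y].
      by move: pjy; rewrite -x'y (eqP rx') ltxx.
    have := ynoroot x'.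
    by rewrite in_itv /= x'0 x'y (rootP _ _ rx') => /(_ isT).
  have y01 : 0 <= y <= 1 by rewrite (ltW y0) (le_trans yx).
  have : 0 < P.[y] by rewrite horner_prod prodr_gt0 // => j _; apply: pge.
  by rewrite Py ltxx.
- rewrite in_itv /= x0 (rootP _ _ rx) (le_lt_trans x1) ?ltr1n //.
  by move=> /(_ isT).
Qed.

Variable d : nat.
Implicit Types (X Y : 'M[R]_d) (v w x z : 'cV[R]_d).

(* With [Z_t = Y0 + t (Y1 - Y0)], the solution of [x_t = Z_t x_t + 1] is a
   rational function of [t] without pole on [[0, 1]]. It starts positive, and
   it never leaves the positive orthant since [x_t >= 0] forces [x_t >= 1].
   Multiplying by [det (1 - Z_t) ^ 2] makes it polynomial. *)
Lemma homotopy_subinvariant Y0 Y1 z0 :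
  nonneg_mx Y0 -> nonneg_mx Y1 -> pos_mx z0 ->
  (forall i, (Y0 *m z0) i 0 < z0 i 0) ->
  (forall (t : R) w, 0 <= t <= 1 -> (Y0 + t *: (Y1 - Y0)) *m w = w -> w = 0) ->
  exists2 z : 'cV[R]_d, pos_mx z & forall i, (Y1 *m z) i 0 < z i 0.
Proof.
move=> Y0ge Y1ge z0pos Y0z0 noeig.
pose Z (t : R) := Y0 + t *: (Y1 - Y0).
pose Q : 'M[{poly R}]_d := map_mx polyC (1%:M - Y0) - 'X *: map_mx polyC (Y1 - Y0).
have evQ t : map_mx (horner_eval t) Q = 1%:M - Z t.
  apply/matrixP => i j; rewrite !mxE /horner_eval /=.
  by rewrite !(hornerD, hornerN, hornerM, hornerC, hornerX); ring.
pose dl := \det Q; pose n := \adj Q *m const_mx 1 : 'cV_d.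
(* One factor [dl] clears the denominator of the inverse; the other makes the scaling a square, so
   its sign is known. *)
pose p i := dl * n i 0; pose pt t : 'cV_d := \col_i (p i).[t].
have dlE t : dl.[t] = \det (1%:M - Z t) by rewrite -evQ det_map_mx.
have ptE t : (1%:M - Z t) *m pt t = dl.[t] ^+ 2 *: const_mx 1.
  have -> : pt t = dl.[t] *: (\adj (1%:M - Z t) *m const_mx 1).
    apply/colP => i; rewrite !mxE hornerM [n i 0]mxE.
    congr (_ * _); rewrite horner_sum; apply: eq_bigr => j _.
    rewrite hornerM -evQ -map_mx_adj [map_mx _ _ _ _]mxE; congr (_ * _).
    by rewrite !mxE hornerE.
  by rewrite -scalemxAr mulmxA mul_mx_adj mul_scalar_mx scalerA -dlE expr2.
have dl0 t : 0 <= t <= 1 -> 0 < dl.[t] ^+ 2.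
  move=> t01; rewrite exprn_even_gt0 //= dlE -det_tr; apply/negP => /det0P[w w0].
  move=> /(congr1 trmx); rewrite trmx_mul trmxK trmx0 mulmxBl mul1mx => /eqP.
  rewrite subr_eq0 eq_sym => /eqP /(noeig _ _ t01) /(congr1 trmx) /eqP.
  by rewrite trmxK trmx0 (negPf w0).
have Zge t : 0 <= t <= 1 -> nonneg_mx (Z t).
  move=> /andP[t0 t1] i j; rewrite !mxE.
  have -> : Y0 i j + t * (Y1 i j - Y0 i j) = (1 - t) * Y0 i j + t * Y1 i j by ring.
  by rewrite addr_ge0 // mulr_ge0 // subr_ge0.
have ptE' t i : (pt t) i 0 = (Z t *m pt t) i 0 + dl.[t] ^+ 2.
  have := congr1 (fun u : 'cV_d => u i 0) (ptE t).
  by rewrite mulmxBl mul1mx !mxE => h; lra.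
have pt_gt0 t : 0 <= t <= 1 -> nonneg_mx (pt t) -> pos_mx (pt t).
  move=> t01 ge0 i j; rewrite ord1 ptE' ltr_wpDl ?dl0 //.
  exact: mulmx_nonneg (Zge _ t01) ge0 _ _.
have t0 : 0 <= (0 : R) <= 1 by rewrite lexx ler01.
have t1 : 0 <= (1 : R) <= 1 by rewrite lexx ler01.
have Z1 : Z 1 = Y1 by rewrite /Z scale1r addrC subrK.
have Z0 : Z 0 = Y0 by rewrite /Z scale0r addr0.
have p1 : forall i, 0 < (p i).[1].
  apply: poly_family_gt0 => [i|t t01 pge i].
    have : pos_mx (pt 0).
      (* At [t = 0] the given [z0] supplies the minimum principle. *)
      apply: pt_gt0 => //; apply: (subinv_nonneg Y0ge z0pos Y0z0) => j.
      by have := ptE' 0 j; rewrite Z0 => ->; rewrite lerDl ltW ?dl0.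
    by move=> /(_ i 0); rewrite mxE.
  have : pos_mx (pt t) by apply: pt_gt0 => // j k; rewrite mxE.
  by move=> /(_ i 0); rewrite mxE.
exists (pt 1) => [i j|i]; first by rewrite mxE.
by rewrite [ltRHS]ptE' Z1 ltrDl dl0.
Qed.

(** Homotopy from 0 to [Y / s]: a nonzero vector fixed by [t Y / s] would be an eigenvector of [Y]
    for [s / t >= s]. *)
Lemma strict_subinvariant Y (s : R) : nonneg_mx Y -> 0 < s ->
  (forall l w, s <= l -> Y *m w = l *: w -> w = 0) ->
  exists2 z : 'cV[R]_d, pos_mx z & forall i, (Y *m z) i 0 < s * z i 0.
Proof.
move=> Yge s0 noeig.
have sY : nonneg_mx (s^-1 *: Y).
  by move=> i j; rewrite mxE mulr_ge0 // invr_ge0 ltW.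
have Z0 : nonneg_mx (0 : 'M[R]_d) by move=> i j; rewrite mxE.
have one_gt0 : pos_mx (const_mx 1 : 'cV[R]_d) by move=> i j; rewrite mxE.
have [||z z0 zP] := homotopy_subinvariant Z0 sY one_gt0.
- by move=> i; rewrite mul0mx !mxE.
- move=> t w /andP[t0 t1]; rewrite add0r subr0 scalerA -scalemxAl.
  have [->|tn0] := eqVneq t 0; first by rewrite mul0r scale0r => <-.
  have tp : 0 < t by rewrite lt_neqAle eq_sym tn0.
  move=> tw; apply: (noeig (s / t)).
    by rewrite ler_pdivlMr // ler_piMr // ltW.
  rewrite -{2}tw scalerA mulrA divfK // mulfV ?gt_eqF //.
  by rewrite scale1r.
exists z => // i; move: (zP i); rewrite -scalemxAl mxE.
by rewrite ltr_pdivrMl.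
Qed.

Lemma strict_subinvariant_of_no_fixpoint Y :
  nonneg_mx Y -> spectral_radius Y <= 1 -> (forall w, Y *m w = w -> w = 0) ->
  exists2 z : 'cV[R]_d, pos_mx z & forall i, (Y *m z) i 0 < z i 0.
Proof.
move=> Yge rY noeig.
have [|z zpos Yz] := strict_subinvariant Yge (@ltr01 R).
  move=> l w l1 Yw; apply/eqP; apply: contraT => w0.
  have l1' : l = 1.
    by apply/le_anti; rewrite l1 (le_trans (eigenvector_le_spectral_radius Yw w0)).
  by rewrite (noeig w) ?eqxx // in w0; rewrite Yw l1' scale1r.
by exists z => // i; rewrite -[ltRHS]mul1r.
Qed.

End Homotopy.

(** * Perron-Frobenius facts for positive matrices *)

Section Perron.
Variables (R : rcfType) (d : nat).
Implicit Types (X Y A : 'M[R]_d) (v w u : 'cV[R]_d).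

(** The moduli [m] of [w] satisfy [m <= X m]. If equality failed, positivity of [X] would give
    [X z > (1 + t) z] for [z = X m] and some [t > 0]. As [1 + t] exceeds the spectral radius, some
    [x > 0] has [X x < (1 + t) x], against [collatz_wielandt]. *)
Lemma perron_pos_fixpoint X w :
  pos_mx X -> spectral_radius X <= 1 -> X *m w = w -> w != 0 ->
  exists2 z : 'cV[R]_d, pos_mx z & X *m z = z.
Proof.
move=> Xpos rX Xw w0; pose m : 'cV[R]_d := \col_i `|w i 0|.
have Xge := pos_nonneg Xpos.
have mge : nonneg_mx m by move=> i j; rewrite mxE.
have m0 : m != 0.
  apply: contraNneq w0 => /colP m0; apply/eqP/colP => i.
  by apply/eqP; have := m0 i; rewrite !mxE => /eqP; rewrite normr_eq0.
have mpos := mulmx_pos Xpos mge m0.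
have [Xm|Xm] := eqVneq (X *m m) m; first by exists m; rewrite // -Xm.
pose e := X *m m - m.
have ege : nonneg_mx e.
  move=> i j; rewrite ord1 mxBE subr_ge0 [m i 0]mxE -{1}Xw !mxE.
  apply: (le_trans (ler_norm_sum _ _ _)); apply: ler_sum => k _.
  by rewrite normrM mxE ger0_norm.
have epos : pos_mx (X *m e) by apply: mulmx_pos; rewrite // subr_eq0.
pose z := X *m m.
have [t /andP[t0 _] zt] : exists2 t, 0 < t < 1 &
    forall i, 0 < (X *m z) i 0 - (1 + t) * z i 0.
  apply: near0_pos_witness; apply: near0_all => i.
  apply: (cont0_gt0 (f := fun t => (X *m z) i 0 - (1 + t) * z i 0)).
    apply: cont0B; first exact: cont0_cst.
    by apply: cont0M; [apply: cont0D; [apply: cont0_cst|apply: cont0_id]|apply: cont0_cst].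
  by have := epos i 0; rewrite mulmxBr addr0 mul1r mxBE.
have s0 : 0 < 1 + t by lra.
have [|x xpos Xx] := strict_subinvariant Xge s0.
  move=> l y sl Xy; apply/eqP; apply: contraT => y0.
  have := eigenvector_le_spectral_radius Xy y0; lra.
have [||i] := @collatz_wielandt _ _ X x z (1 + t) Xge xpos (pos_nonneg mpos).
- by have [i _] := neq0_cV_ex m0; apply/eqP => /colP/(_ i) zi; have := mpos i 0;
    rewrite -/z zi mxE ltxx.
- by move=> i; have := zt i; rewrite subr_gt0 => /ltW.
- by rewrite leNgt Xx.
Qed.

(** The positive part [m] of [u] satisfies [m <= X^T m]. Pairing the difference with [v > 0], fixed
    by [X], gives 0, so [X^T m = m]; then [m] is either zero or entrywise positive. *)
Lemma left_fixpoint_sign X v u :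
  pos_mx X -> pos_mx v -> X *m v = v -> X^T *m u = u ->
  nonneg_mx u \/ nonneg_mx (- u).
Proof.
move=> Xpos vpos Xv Xu; pose m : 'cV[R]_d := \col_i Num.max (u i 0) 0.
have XTpos : pos_mx X^T by move=> i j; rewrite mxE.
have mge : nonneg_mx m by move=> i j; rewrite mxE le_max lexx orbT.
have [m0|m0] := eqVneq m 0.
  right => i j; rewrite ord1 mxE oppr_ge0.
  have : u i 0 <= m i 0 by rewrite mxE le_max lexx.
  by rewrite m0 mxE.
pose e := X^T *m m - m.
have ege i : 0 <= e i 0.
  rewrite mxBE subr_ge0 {1}mxE ge_max.
  rewrite (mulmx_nonneg (pos_nonneg XTpos) mge) andbT -{1}Xu !mxE.
  by apply: ler_sum => k _; rewrite ler_wpM2l ?(pos_nonneg XTpos) // mxE le_max lexx.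
have ve : \sum_i v i 0 * e i 0 = 0.
  transitivity ((v^T *m e) 0 0).
    by rewrite mxE; apply: eq_bigr => i _; rewrite [v^T _ _]mxE.
  by rewrite mulmxBr mulmxA -trmx_mul Xv subrr mxE.
have e0 i : e i 0 = 0.
  have /eqP := ve; rewrite psumr_eq0 => [/allP/(_ i)|j _]; last first.
    by rewrite mulr_ge0 ?ege // ltW.
  by rewrite mem_index_enum mulf_eq0 gt_eqF //= => /(_ isT)/eqP.
left => i j; rewrite ord1.
have := mulmx_pos XTpos mge m0 i 0.
have -> : (X^T *m m) i 0 = m i 0.
  by have /eqP := e0 i; rewrite mxBE subr_eq0 => /eqP.
by rewrite mxE lt_max ltxx orbF => /ltW.
Qed.

End Perron.

(** * Squared Frobenius norm and its inner product *)

Section Frobenius.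
Variable R : rcfType.

Definition sqfrob m n (X : 'M[R]_(m, n)) : R := \sum_i \sum_j X i j ^+ 2.

Lemma sqfrob_ge0 m n (X : 'M[R]_(m, n)) : 0 <= sqfrob X.
Proof. by apply: sumr_ge0 => i _; apply: sumr_ge0 => j _; apply: sqr_ge0. Qed.

Lemma frob_le m n p q (X : 'M[R]_(m, n)) (Y : 'M[R]_(p, q)) :
  (frob X <= frob Y) = (sqfrob X <= sqfrob Y).
Proof. by rewrite /frob -/(sqfrob X) ler_sqrt // sqfrob_ge0. Qed.

Lemma sqfrobE m n (X : 'M[R]_(m, n)) : sqfrob X = \tr (X *m X^T).
Proof.
apply: eq_bigr => i _; rewrite mxE; apply: eq_bigr => j _.
by rewrite mxE expr2.
Qed.

Lemma sqfrob_eq0 m n (X : 'M[R]_(m, n)) : (sqfrob X == 0) = (X == 0).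
Proof.
apply/eqP/eqP => [X0|->]; last first.
  by apply: big1 => i _; apply: big1 => j _; rewrite mxE expr0n.
apply/matrixP => i j; rewrite mxE; apply/eqP; rewrite -sqrf_eq0.
have row_ge0 k : 0 <= \sum_l X k l ^+ 2 by apply: sumr_ge0 => l _; apply: sqr_ge0.
have /eqP := X0; rewrite psumr_eq0 // => /allP/(_ i).
rewrite mem_index_enum /= => /(_ isT); rewrite psumr_eq0 => [|l _]; last exact: sqr_ge0.
by move=> /allP/(_ j); rewrite mem_index_enum /= => /(_ isT).
Qed.

Lemma sqfrob_gt0 m n (X : 'M[R]_(m, n)) : (0 < sqfrob X) = (X != 0).
Proof. by rewrite lt_neqAle sqfrob_ge0 andbT eq_sym sqfrob_eq0. Qed.

Lemma sqfrobZ m n (a : R) (X : 'M[R]_(m, n)) : sqfrob (a *: X) = a ^+ 2 * sqfrob X.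
Proof. by rewrite !sqfrobE linearZ -scalemxAr -scalemxAl !linearZ /= mulrA expr2. Qed.

(** The trace in the middle term is the Frobenius inner product. *)
Lemma sqfrobDZ m n (t : R) (X Y : 'M[R]_(m, n)) :
  sqfrob (X + t *: Y) = sqfrob X + 2 * t * \tr (X *m Y^T) + t ^+ 2 * sqfrob Y.
Proof.
rewrite -sqfrobZ !sqfrobE linearD mulmxDr !mulmxDl !linearD /=.
have -> : \tr (t *: Y *m X^T) = \tr (X *m (t *: Y)^T).
  by rewrite -mxtrace_tr trmx_mul trmxK.
have -> : \tr (X *m (t *: Y)^T) = t * \tr (X *m Y^T).
  by rewrite linearZ -scalemxAr linearZ.
ring.
Qed.

Lemma sqfrob_outer p q (a : 'cV[R]_p) (b : 'cV[R]_q) :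
  sqfrob (a *m b^T) = sqfrob a * sqfrob b.
Proof.
rewrite [sqfrob a]/sqfrob mulr_suml; apply: eq_bigr => i _; rewrite big_ord1.
rewrite mulr_sumr; apply: eq_bigr => j _.
by rewrite big_ord1 !mxE big_ord1 mxE exprMn.
Qed.

Lemma mul_trcV d (v : 'cV[R]_d) : v^T *m v = (sqfrob v)%:M.
Proof. by rewrite [LHS]mx11_scalar sqfrobE mxtrace_mulC trace_mx11. Qed.

Lemma vnormE d (v : 'cV[R]_d) : vnorm v = Num.sqrt (sqfrob v).
Proof. by congr Num.sqrt; apply: eq_bigr => i _; rewrite big_ord1. Qed.

Lemma segment_dist m n (t : R) (X Y : 'M[R]_(m, n)) :
  sqfrob (X + t *: (Y - X) - Y) = (1 - t) ^+ 2 * sqfrob (X - Y).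
Proof.
rewrite -sqfrobZ; congr sqfrob; apply/matrixP => i j; rewrite !mxE; ring.
Qed.

End Frobenius.

(** * Orthogonal projection onto the matrices fixing a vector *)

Section FixingProjection.
Variables (R : rcfType) (d : nat).
Implicit Types (A Z : 'M[R]_d) (w : 'cV[R]_d).

(* The matrix closest to [A] among those fixing [w]. *)
Definition proj_fix A w := A - (sqfrob w)^-1 *: ((A - 1%:M) *m w *m w^T).

Lemma proj_fixP A w : w != 0 -> proj_fix A w *m w = w.
Proof.
rewrite -sqfrob_gt0 => w0; rewrite mulmxBl -scalemxAl -[_ *m w^T *m w]mulmxA mul_trcV.
rewrite mul_mx_scalar scalerA mulVf ?gt_eqF // scale1r mulmxBl mul1mx.
by rewrite opprB addrC subrK.
Qed.

Lemma proj_fix_dist A w : w != 0 ->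
  sqfrob (proj_fix A w - A) = sqfrob ((A - 1%:M) *m w) / sqfrob w.
Proof.
rewrite -sqfrob_gt0 => w0; rewrite /proj_fix addrAC subrr add0r -scaleNr sqfrobZ.
by rewrite sqfrob_outer; field; rewrite gt_eqF.
Qed.

(** [Z - proj_fix A w] kills [w], and [proj_fix A w - A] has rank at most one with right factor
    [w^T], so the two are orthogonal. *)
Lemma proj_fix_pythagoras A Z w : w != 0 -> Z *m w = w ->
  sqfrob (Z - A) = sqfrob (Z - proj_fix A w) + sqfrob ((A - 1%:M) *m w) / sqfrob w.
Proof.
move=> w0 Zw; rewrite -proj_fix_dist //.
have -> : Z - A = (Z - proj_fix A w) + 1 *: (proj_fix A w - A).
  by rewrite scale1r addrA subrK.
rewrite sqfrobDZ expr1n mul1r [X in _ * X](_ : _ = 0) ?mulr0 ?addr0 //.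
rewrite {2}/proj_fix [A - _ - A]addrAC subrr add0r -scaleNr.
rewrite linearZ /= trmx_mul trmxK -scalemxAr mulmxA mulmxBl Zw proj_fixP //.
by rewrite subrr mul0mx scaler0 linear0.
Qed.

Lemma fix_dist_ge A Z w : w != 0 -> Z *m w = w ->
  sqfrob ((A - 1%:M) *m w) <= sqfrob (Z - A) * sqfrob w.
Proof.
move=> w0 Zw; rewrite -ler_pdivrMr ?sqfrob_gt0 //.
by rewrite (proj_fix_pythagoras A w0 Zw) lerDr sqfrob_ge0.
Qed.

End FixingProjection.

(** Moving a fraction [t] of the way to a target scales the squared distance by [(1 - t) ^ 2]; if
    this does not decrease it, the target was already reached. *)
Lemma contraction_eq0 (R : rcfType) (t c : R) : 0 < t < 1 -> 0 <= c -> c <= (1 - t) ^+ 2 * c -> c = 0.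
Proof.
move=> /andP[t0 t1]; rewrite le_eqVlt => /predU1P[<-//|c0].
rewrite -{1}[c]mul1r ler_pM2r // => h.
have : 0 < t * (1 - t) by rewrite mulr_gt0 // subr_gt0.
move: h; rewrite expr2; lra.
Qed.

(** * Necessary conditions at a positive local minimum *)

Section LocalMinimum.
Variables (R : rcfType) (d : nat) (A X : 'M[R]_d).
Hypotheses (rhoA : 1 < spectral_radius A) (Xpos : pos_mx X) (locX : local_min_P A X).
Implicit Types (Y Z : 'M[R]_d) (v w z u : 'cV[R]_d).
Local Notation B := (A - 1%:M).

(* In dimension 0 the spectral radius is a junk value, possibly above 1, but
   there [A = X] and [X] is feasible. *)
Lemma dim_gt0 : (0 < d)%N.
Proof.
case: d A X rhoA locX => // A' X' rho [[_ +] _].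
have -> : X' = A' by apply/matrixP => i; have := ltn_ord i; rewrite ltn0.
by rewrite leNgt rho.
Qed.

Lemma not_subinvariant z : nonneg_mx A -> pos_mx z ->
  ~ forall i, (A *m z) i 0 <= z i 0.
Proof.
move=> Age zpos Az; have := rhoA; rewrite ltNge.
rewrite (spectral_radius_le dim_gt0 Age zpos) // => i.
by rewrite mul1r.
Qed.

Lemma min_neq : X != A.
Proof.
apply/eqP => XA; case: locX => -[_]; rewrite XA => /(lt_le_trans rhoA).
by rewrite ltxx.
Qed.

(** Near 0 the path stays close to [X] and, since [X > 0], entrywise positive; the vector [z] bounds
    its spectral radius by 1, so it is feasible. *)
Lemma local_min_path (Y : R -> 'M[R]_d) :
  (forall i j, cont0 (fun t => Y t i j)) -> Y 0 = X ->
  near0 (fun t => exists2 z : 'cV[R]_d, pos_mx z & forall i, (Y t *m z) i 0 <= z i 0) ->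
  near0 (fun t => sqfrob (X - A) <= sqfrob (Y t - A)).
Proof.
move=> cY Y0 sub; have [_ [eps [eps0 minX]]] := locX.
have Ypos : near0 (fun t => forall i j, 0 < Y t i j).
  by do 2![apply: near0_all => ?]; apply: cont0_gt0; rewrite // Y0.
have Yeps : near0 (fun t => 0 < eps ^+ 2 - sqfrob (Y t - X)).
  apply: (cont0_gt0 (f := fun t => eps ^+ 2 - sqfrob (Y t - X))); last first.
    by rewrite Y0 subrr (eqP (_ : sqfrob 0 == 0)) ?sqfrob_eq0 // subr0 exprn_gt0.
  apply: cont0B; first exact: cont0_cst.
  apply: cont0_sum => i; apply: cont0_sum => j e e0.
  have cYX := cont0B (cY i j) (@cont0_cst _ (X i j)).
  apply: near0_imp (cont0M cYX cYX e0) => t.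
  by rewrite !mxBE !expr2.
apply: near0_imp (near0_and sub (near0_and Ypos Yeps)) => t [[z zpos Yz] [Yt Ye]].
rewrite -frob_le; apply: minX; last first.
  have -> : eps = Num.sqrt (eps ^+ 2) by rewrite sqrtr_sqr gtr0_norm.
  by rewrite /frob ltr_sqrt ?exprn_gt0 // -subr_gt0.
have Yge : nonneg_mx (Y t) by move=> i j; apply: ltW.
split=> //; apply: (spectral_radius_le dim_gt0 Yge zpos) => i.
by rewrite mul1r.
Qed.

Lemma local_min_perron : exists2 v : 'cV[R]_d, pos_mx v & X *m v = v.
Proof.
have [[Xge rX] _] := locX.
have [det0|detN0] := eqVneq (\det (1%:M - X)) 0.
  have /det0P[w w0] : \det (1%:M - X)^T == 0 by rewrite det_tr det0.
  move=> /(congr1 trmx); rewrite trmx_mul trmxK trmx0 mulmxBl mul1mx => /eqP.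
  rewrite subr_eq0 eq_sym => /eqP Xw.
  apply: (perron_pos_fixpoint Xpos rX Xw).
  by apply: contraNneq w0 => /(congr1 trmx); rewrite trmxK trmx0 => ->.
have [|z zpos Xz] := strict_subinvariant_of_no_fixpoint Xge rX.
  move=> w Xw; have U : 1%:M - X \in unitmx by rewrite unitmxE unitfE.
  by rewrite -[w](mulKmx U) mulmxBl mul1mx Xw subrr mulmx0.
have [|||t t01 Yt] := near0_pos_witness (local_min_path (Y := fun t => X + t *: (A - X)) _ _ _).
- by move=> i j; apply: cont0_affine_mx.
- by rewrite scale0r addr0.
(* The strict inequality [X z < z] survives small [t] with the same [z]. *)
- have : near0 (fun t => forall i, 0 < (z - X *m z) i 0 + t * ((X - A) *m z) i 0).
    apply: near0_all => i; apply: cont0_gt0; first exact: cont0_affine.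
    by rewrite mul0r addr0 mxBE subr_gt0.
  apply: near0_imp => t zt; exists z => // i; have := zt i.
  rewrite mxBE [(X + t *: _) *m z]mulmxDl -scalemxAl affine_mxE !mulmxBl !mxBE; lra.
move: Yt; rewrite segment_dist // => /(contraction_eq0 t01 (sqfrob_ge0 _))/eqP.
by rewrite sqfrob_eq0 subr_eq0 (negPf min_neq).
Qed.

Lemma local_min_proj v : pos_mx v -> X *m v = v -> X = proj_fix A v.
Proof.
move=> vpos Xv; have v0 : v != 0.
  apply/eqP => /colP/(_ (Ordinal dim_gt0)) v0.
  by have := vpos (Ordinal dim_gt0) 0; rewrite v0 mxE ltxx.
set Y := proj_fix A v; have Yv : Y *m v = v by apply: proj_fixP.
have Ztv t : (X + t *: (Y - X)) *m v = v.
  by rewrite mulmxDl -scalemxAl mulmxBl Xv Yv subrr scaler0 addr0.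
have [|||t t01 Yt] := near0_pos_witness (local_min_path (Y := fun t => X + t *: (Y - X)) _ _ _).
- by move=> i j; apply: cont0_affine_mx.
- by rewrite scale0r addr0.
- by exists 1 => // t _; exists v => // i; rewrite Ztv.
(* Both matrices fix [v], so the common term of the two Pythagoras identities cancels and only
   distances to [Y] remain. *)
move: Yt; rewrite (proj_fix_pythagoras A v0 Xv) (proj_fix_pythagoras A v0 (Ztv t)).
rewrite lerD2r segment_dist // => /(contraction_eq0 t01 (sqfrob_ge0 _))/eqP.
by rewrite sqfrob_eq0 subr_eq0 => /eqP.
Qed.

(** Local minimality along [v + t w] is a quadratic inequality in [t]. Its linear term vanishes,
    giving the eigenvector equation, and its leading coefficient is nonnegative, which is the bound
    for every [w], near [v] or not. *)
Lemma local_min_rayleigh v : pos_mx v -> X *m v = v -> sqfrob v = 1 ->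
  let mu := sqfrob (B *m v) in
  B^T *m B *m v = mu *: v /\ forall w, mu * sqfrob w <= sqfrob (B *m w).
Proof.
move=> vpos Xv v1 mu; have v0 : v != 0 by rewrite -sqfrob_gt0 v1 ltr01.
have XE := local_min_proj vpos Xv.
have muE : sqfrob (X - A) = mu by rewrite XE proj_fix_dist // v1 divr1.
have key w : near0 (fun t => mu * sqfrob (v + t *: w) <= sqfrob (B *m (v + t *: w))).
  pose z t := v + t *: w.
  have zpos : near0 (fun t => forall i, 0 < z t i 0).
    apply: near0_all => i; apply: cont0_gt0; first exact: cont0_affine_mx.
    by rewrite /z scale0r addr0.
  have zN0 t : (forall i, 0 < z t i 0) -> z t != 0.
    move=> zt; apply/eqP => /colP/(_ (Ordinal dim_gt0)) zt0.
    by have := zt (Ordinal dim_gt0); rewrite zt0 mxE ltxx.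
  have cz i : cont0 (fun t => z t i 0) by apply: cont0_affine_mx.
  have Bzt t : B *m z t = B *m v + t *: (B *m w) by rewrite mulmxDr -scalemxAr.
  have cz2 : cont0 (fun t => sqfrob (z t)).
    apply: cont0_sum => i; apply: cont0_sum => j e e0; rewrite ord1.
    by apply: near0_imp (cont0M (cz i) (cz i) e0) => t; rewrite !expr2.
  have z0 : z 0 = v by rewrite /z scale0r addr0.
  have [|||e e0 h] := @local_min_path (fun t => proj_fix A (z t)).
  - move=> i j e e0.
    have cf : cont0 (fun t => A i j - (sqfrob (z t))^-1 *
        ((B *m v + t *: (B *m w)) i 0 * z t j 0)).
      apply: cont0B; first exact: cont0_cst.
      apply: cont0M; last by apply: cont0M => //; apply: cont0_affine_mx.
      by apply: cont0V; rewrite // z0 v1 ltr01.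
    apply: near0_imp (cf _ e0) => t.
    have E s : proj_fix A (z s) i j = A i j - (sqfrob (z s))^-1 *
        ((B *m v + s *: (B *m w)) i 0 * z s j 0).
      rewrite -Bzt /proj_fix mxBE; congr (_ - _).
      by rewrite mxE; congr (_ * _); rewrite mxE big_ord1 [(z s)^T _ _]mxE.
    by rewrite !E.
  - by rewrite z0 -XE.
  - apply: near0_imp zpos => t zt; exists (z t) => [i j|i]; first by rewrite ord1.
    by rewrite proj_fixP // zN0.
  apply: near0_imp (near0_and zpos (ex_intro2 _ _ e e0 h)) => t [/zN0 zt].
  by rewrite muE proj_fix_dist // ler_pdivlMr // sqfrob_gt0.
have quad w : \tr ((B^T *m B *m v - mu *: v) *m w^T) = 0 /\
    0 <= sqfrob (B *m w) - mu * sqfrob w.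
  apply: quadratic_ge0_near0; apply: near0_imp (key w) => t.
  rewrite mulmxDr -scalemxAr !sqfrobDZ v1 -/mu -subr_ge0.
  have -> : \tr ((B^T *m B *m v - mu *: v) *m w^T) =
      \tr (B *m v *m (B *m w)^T) - mu * \tr (v *m w^T).
    rewrite mulmxBl linearB /= -scalemxAl linearZ /=; congr (_ - _).
    by rewrite trmx_mul -!mulmxA mxtrace_mulC !mulmxA.
  lra.
split=> [|w]; last by have [_] := quad w; rewrite subr_ge0.
(* With the residual itself as direction, the vanishing trace is its squared norm. *)
have [+ _] := quad (B^T *m B *m v - mu *: v); rewrite -sqfrobE => /eqP.
by rewrite sqfrob_eq0 subr_eq0 => /eqP.
Qed.

End LocalMinimum.

(** * From local to global minimality *)

Section GlobalMinimum.
Variables (R : rcfType) (d : nat) (A : 'M[R]_d).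
Hypotheses (Age : nonneg_mx A) (rhoA : 1 < spectral_radius A).

(** If [Y] were closer, the whole segment from [Y] to [A] would be too close to [A] to fix a nonzero
    vector, and the homotopy would carry a subinvariant vector from [Y] to [A], against
    [not_subinvariant]. *)
Lemma feasible_dist_ge (X Y : 'M[R]_d) (mu : R) :
  pos_mx X -> local_min_P A X ->
  (forall w : 'cV[R]_d, mu * sqfrob w <= sqfrob ((A - 1%:M) *m w)) ->
  feasible Y -> mu <= sqfrob (Y - A).
Proof.
move=> Xpos locX ray [Yge rY]; rewrite leNgt; apply/negP => lt_mu.
have noeig (t : R) (w : 'cV[R]_d) :
    0 <= t <= 1 -> (Y + t *: (A - Y)) *m w = w -> w = 0.
  move=> /andP[t0 t1] Zw; apply/eqP; apply: contraT => w0.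
  have := le_trans (ray w) (fix_dist_ge A w0 Zw).
  rewrite ler_pM2r ?sqfrob_gt0 // leNgt => /negP; case.
  rewrite segment_dist; apply: le_lt_trans lt_mu.
  rewrite ler_piMl ?sqfrob_ge0 // expr_le1 // ?subr_ge0 // lerBlDr lerDl //.
have [|z0 z0pos Yz0] := strict_subinvariant_of_no_fixpoint Yge rY.
  by move=> w Yw; apply: (noeig 0); rewrite ?lexx ?ler01 // scale0r addr0.
have [z zpos Az] := homotopy_subinvariant Yge Age z0pos Yz0 noeig.
by apply: (not_subinvariant rhoA locX Age zpos) => i; apply: ltW.
Qed.

End GlobalMinimum.

(** * Eigenvalues of Gram matrices *)

Lemma gram_eigenvalue_ge (R : rcfType) (m n : nat) (B : 'M[R]_(m, n)) (mu l : R) :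
  (forall w : 'cV[R]_n, mu * sqfrob w <= sqfrob (B *m w)) ->
  eigenvalue (B^T *m B) l -> mu <= l.
Proof.
move=> ray /eigenvalueP[r rM r0].
have w0 : r^T != 0 by apply: contraNneq r0 => /(congr1 trmx); rewrite trmxK trmx0 => ->.
have := ray r^T; suff -> : sqfrob (B *m r^T) = l * sqfrob r^T.
  by rewrite ler_pM2r ?sqfrob_gt0.
rewrite !sqfrobE trmx_mul trmxK mxtrace_mulC mulmxA -[r *m _ *m _]mulmxA rM.
by rewrite -scalemxAl linearZ /= mxtrace_mulC.
Qed.

Lemma symmetric_eigenvalue (R : rcfType) (n : nat) (M : 'M[R]_n) (v : 'cV[R]_n) (l : R) :
  M^T = M -> M *m v = l *: v -> v != 0 -> eigenvalue M l.
Proof.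
move=> symM Mv v0; apply/eigenvalueP; exists v^T.
  by rewrite -[M in LHS]symM -trmx_mul Mv linearZ.
by apply: contraNneq v0 => /(congr1 trmx); rewrite trmxK trmx0 => ->.
Qed.

(** Since [mu > 0], [B] is invertible, so [r *m B] is a nonzero eigenvector of [B^T *m B] for the
    same [l]. *)
Lemma cogram_eigenvalue_ge (R : rcfType) (n : nat) (B : 'M[R]_n) (mu l : R) :
  0 < mu -> (forall w : 'cV[R]_n, mu * sqfrob w <= sqfrob (B *m w)) ->
  eigenvalue (B *m B^T) l -> mu <= l.
Proof.
move=> mu0 ray /eigenvalueP[r rN r0].
have rB0 : r *m B != 0.
  apply: contraNneq r0 => rB.
  have U : B \in unitmx.
    rewrite unitmxE unitfE -det_tr; apply/negP => /det0P[w w0] /(congr1 trmx).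
    rewrite trmx_mul trmxK trmx0 => Bw; have := ray w^T.
    rewrite Bw (eqP (_ : sqfrob 0 == 0)) ?sqfrob_eq0 // pmulr_rle0 //.
    rewrite leNgt sqfrob_gt0; apply/negP; rewrite negbK; apply: contraNneq w0.
    by move=> /(congr1 trmx); rewrite trmxK trmx0 => ->.
  by rewrite -[r](mulmxK U) rB mul0mx.
apply: (gram_eigenvalue_ge ray); apply/eigenvalueP; exists (r *m B) => //.
by rewrite -mulmxA (mulmxA B) [LHS]mulmxA rN scalemxAl.
Qed.

(** * Both leading eigenvectors and the rank-one formula *)

Theorem theorem4 (R : rcfType) (d : nat) (A : 'M[R]_d) :
  nonneg_mx A -> irreducible_mx A -> 1 < spectral_radius A ->
  let M := (1%:M - A^T) *m (1%:M - A) in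
  let N := (1%:M - A) *m (1%:M - A^T) in
  (forall X : 'M[R]_d, pos_mx X -> local_min_P A X ->
     global_min_P A X /\
     (exists v, right_leading X v /\ vnorm v = 1) /\
     (forall v, right_leading X v -> vnorm v = 1 ->
        exists mu, smallest_eigenvalue M mu /\ M *m v = mu *: v /\ 0 < mu /\
          (let u := (Num.sqrt mu)^-1 *: ((A - 1%:M) *m v) in
           left_leading X u /\
           (exists nu, smallest_eigenvalue N nu /\ N *m u = nu *: u)) /\
          X = A - (A - 1%:M) *m v *m v^T /\
          frob (X - A) = Num.sqrt mu)) /\
  ((~ exists (mu : R) (v : 'cV[R]_d), smallest_eigenvalue M mu /\ M *m v = mu *: v /\
        nonneg_mx v /\ vnorm v = 1 /\ nonneg_mx ((A - 1%:M) *m v) /\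
        nonneg_mx (A - (A - 1%:M) *m v *m v^T)) ->
   forall X : 'M[R]_d, pos_mx X -> ~ local_min_P A X).
Proof.
move=> Age _ rhoA M N.
set B := A - 1%:M.
have BT : B^T = A^T - 1%:M by rewrite linearB /= trmx1.
have ME : M = B^T *m B.
  by rewrite /M -(opprB A) -(opprB A^T) mulNmx mulmxN opprK BT.
have NE : N = B *m B^T.
  by rewrite /N -(opprB A) -(opprB A^T) mulNmx mulmxN opprK BT.
have main X : pos_mx X -> local_min_P A X ->
     global_min_P A X /\
     (exists v, right_leading X v /\ vnorm v = 1) /\
     (forall v, right_leading X v -> vnorm v = 1 ->
        exists mu, smallest_eigenvalue M mu /\ M *m v = mu *: v /\ 0 < mu /\
          (let u := (Num.sqrt mu)^-1 *: (B *m v) in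
           left_leading X u /\
           (exists nu, smallest_eigenvalue N nu /\ N *m u = nu *: u)) /\
          X = A - B *m v *m v^T /\
          frob (X - A) = Num.sqrt mu).
  move=> Xpos locX; have [[Xge rX] _] := locX.
  have d0 := dim_gt0 rhoA locX.
  have [z zpos Xz] := local_min_perron rhoA Xpos locX.
  have z0 : z != 0.
    apply/eqP => /colP/(_ (Ordinal d0)) z0.
    by have := zpos (Ordinal d0) 0; rewrite z0 mxE ltxx.
  have rX1 : spectral_radius X = 1.
    apply/le_anti; rewrite rX /=; apply: (eigenvector_le_spectral_radius _ z0).
    by rewrite scale1r.
  have lead v : right_leading X v -> vnorm v = 1 ->
      [/\ pos_mx v, X *m v = v, sqfrob v = 1 & v != 0].
    move=> [vge [v0]]; rewrite rX1 scale1r => Xv v1; split=> //.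
      by rewrite -Xv; apply: mulmx_pos.
    by rewrite -[LHS]sqr_sqrtr ?sqfrob_ge0 // -vnormE v1 expr1n.
  have [v1 [v1lead v1norm]] : exists v, right_leading X v /\ vnorm v = 1.
    have nz0 : 0 < Num.sqrt (sqfrob z) by rewrite sqrtr_gt0 sqfrob_gt0.
    exists ((Num.sqrt (sqfrob z))^-1 *: z); split; last first.
      rewrite vnormE sqfrobZ exprVn sqr_sqrtr ?sqfrob_ge0 // mulVf ?sqrtr1 //.
      by rewrite gt_eqF // sqfrob_gt0.
    split; first by move=> i j; rewrite mxE mulr_ge0 ?invr_ge0 ?ltW.
    split; first by rewrite scaler_eq0 negb_or z0 invr_eq0 gt_eqF.
    by rewrite rX1 scale1r -scalemxAr Xz.
  split; [split=> // Y Yfeas|split=> [|v vlead vnorm1]].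
  - have [vpos Xv v1n v0] := lead _ v1lead v1norm.
    have [_ ray] := local_min_rayleigh rhoA Xpos locX vpos Xv v1n.
    rewrite frob_le [in leLHS](local_min_proj rhoA Xpos locX vpos Xv).
    rewrite proj_fix_dist // v1n divr1.
    exact: (feasible_dist_ge Age rhoA Xpos locX ray Yfeas).
  - by exists v1.
  have [vpos Xv vn v0] := lead _ vlead vnorm1.
  have [Mv ray] := local_min_rayleigh rhoA Xpos locX vpos Xv vn.
  have XE := local_min_proj rhoA Xpos locX vpos Xv.
  move: Mv ray; rewrite -/B; set mu := sqfrob (B *m v) => Mv ray.
  have XE' : X = A - B *m v *m v^T by rewrite {1}XE /proj_fix vn invr1 scale1r.
  have mu0 : 0 < mu.
    rewrite sqfrob_gt0; apply: contraNneq (min_neq rhoA locX) => Bv.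
    by rewrite XE' Bv mul0mx subr0.
  have s0 : 0 < Num.sqrt mu by rewrite sqrtr_gt0.
  have Bv0 : B *m v != 0 by rewrite -sqfrob_gt0.
  set u := (Num.sqrt mu)^-1 *: (B *m v).
  have u0 : u != 0 by rewrite scaler_eq0 negb_or invr_eq0 gt_eqF.
  have BTu : B^T *m u = (Num.sqrt mu)^-1 *: (mu *: v).
    by rewrite -scalemxAr mulmxA Mv.
  have Nu : N *m u = mu *: u.
    by rewrite NE -mulmxA BTu -!scalemxAr scalerA mulrC -scalerA.
  (* [X^T u = A^T u - v v^T B^T u], and [B^T u] is a multiple of the unit vector [v], so [v v^T]
     leaves it unchanged. *)
  have XTu : X^T *m u = u.
    have -> : X^T *m u = A^T *m u - B^T *m u.
      rewrite BTu {1}XE' linearB /= mulmxBl !trmx_mul trmxK; congr (_ - _).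
      by rewrite -!mulmxA BTu -!scalemxAr mul_trcV vn mulmx1.
    by rewrite BT mulmxBl mul1mx subKr.
  (* If [- u] were nonnegative, then [A v <= v] with [v > 0], which [1 < spectral_radius A]
     forbids. *)
  have uge : nonneg_mx u.
    have [//|uneg] := left_fixpoint_sign Xpos vpos Xv XTu.
    case: (not_subinvariant rhoA locX Age vpos) => i.
    have := uneg i 0; rewrite -scalerN mxE pmulr_rge0 ?invr_gt0 //.
    by rewrite mxE mulmxBl mul1mx mxBE oppr_ge0 subr_le0.
  exists mu; split; first split.
  - by apply: (symmetric_eigenvalue _ _ v0); rewrite ME // trmx_mul trmxK.
  - by move=> l; rewrite ME; apply: gram_eigenvalue_ge.
  split; first by rewrite ME.
  split=> //; split; last first.
    split=> //; rewrite /frob; congr Num.sqrt; rewrite -/(sqfrob _) {1}XE.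
    by rewrite proj_fix_dist // vn divr1.
  split.
    by split=> //; split; rewrite // rX1 scale1r -[X]trmxK -trmx_mul XTu.
  exists mu; split=> //; split.
    by apply: (symmetric_eigenvalue _ Nu u0); rewrite NE trmx_mul trmxK.
  by move=> l; rewrite NE; apply: cogram_eigenvalue_ge.
split=> // noV X Xpos locX; apply: noV.
have [_ [[v [vlead vnorm1]] /(_ v vlead vnorm1)]] := main X Xpos locX.
move=> [mu [smu [Mv [mu0 [[[uge _] _] [XE _]]]]]].
exists mu, v; do 3![split=> //]; first by case: vlead.
split=> //; split; last by rewrite -XE; apply: pos_nonneg.
move=> i j; have := uge i j.
by rewrite mxE pmulr_rge0 // invr_gt0 sqrtr_gt0.
Qed.
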